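(* Let $T$ be a $T_{3\frac12}$ (Tichonoff) space, let $\xi$ be any measure of non-compactness on $\mathbb{C}$, and let $\eta$ (defined from $\xi$) and $\omega$ be the functionals on $\mathcal{P}(C^b(T))$ given by $$\eta(\mathcal{F}):=\sup_{t\in T}\xi(\{f(t):f\in\mathcal{F}\}),\qquad \omega(\mathcal{F}):=\sup_{\mathcal{U}\in\operatorname{Wall}(T)}\ \inf_{V}\ \sup_{f\in\mathcal{F}}\ \sup_{t\in V}|\hat f(\mathcal{U})-f(t)|,$$ where the infimum is over all open sets $V\subset T$ with $\mathcal{U}\in V^*$. Then the functional $\Omega:\mathcal{P}(C^b(T))\to[0,+\infty]$, $\Omega(\mathcal{F}):=\omega(\mathcal{F})+\eta(\mathcal{F})$, satisfies properties (MN1)-(MN6). Therefore $\Omega$ is a measure of non-compactness on $C^b(T)$.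
   Context: $C^b(T)$ is the Banach space of bounded continuous functions $T\to\mathbb{C}$ with the supremum norm, and $\mathcal{P}$ denotes the power set. A measure of non-compactness in a Banach space $Y$ is a function $\Omega:\mathcal{P}(Y)\to[0,+\infty]$ such that for all $A,B\subset Y$ and $\lambda\in\mathbb{C}$: (MN1) $\Omega(A)=0$ if and only if $A$ is relatively compact; (MN2) $A\subset B$ implies $\Omega(A)\le\Omega(B)$; (MN3) $\Omega(\overline{A})=\Omega(A)$; (MN4) $\Omega(\lambda A)=|\lambda|\Omega(A)$; (MN5) if $A$ is finite and $A\cap B=\emptyset$ then $\Omega(A\cup B)=\Omega(B)$; (MN6) $\Omega(\operatorname{conv}(A))=\Omega(A)$, where $\operatorname{conv}$ is the convex hull. Convention: $0\cdot(+\infty)=0$. A zero set of $T$ is a set $f^{-1}(\{0\})$ with $f\in C^b(T)$. An $\omega$-ultrafilter on $T$ is a family $\mathcal{U}$ of zero sets of $T$ such that every finite subfamily of $\mathcal{U}$ has non-empty intersection, and which is maximal in the sense that no zero set can be added to it without losing this property. $\operatorname{Wall}(T)$ is the set of all $\omega$-ultrafilters on $T$. For an open set $U\subset T$ put $U^*:=\{\mathcal{U}\in\operatorname{Wall}(T): T\setminus U\notin\mathcal{U}\}$; $\operatorname{Wall}(T)$ is given the topology with base $\{U^*: U\subset T \text{ open}\}$. With the map $\varphi:T\to\operatorname{Wall}(T)$, $\varphi(t)=\{f^{-1}(\{0\}) : f\in C^b(T),\ f(t)=0\}$, $\operatorname{Wall}(T)$ is the Wallman compactification of $T$ (equivalent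 to the Cech-Stone compactification), and each $f\in C^b(T)$ has a continuous extension $\hat f:\operatorname{Wall}(T)\to\mathbb{C}$, with $\hat f(\varphi(t))=f(t)$ for all $t\in T$; the map $f\mapsto\hat f$ (Gelfand transform) is an isometric $*$-isomorphism of $C^b(T)$ onto $C(\operatorname{Wall}(T))$.
   Formalization: In ω the infimum is over open V with 𝒰 ∈ V* whose complement T∖V is a zero set; with all open V the claim is false, since V* = Wall(T) whenever T∖V is not a zero set, and MN1 can then fail. Suprema over empty families are 0. *)

(* Defs.v *)
From HB Require Import structures.
From mathcomp Require Import all_boot all_order all_algebra.
From mathcomp Require Import all_classical all_reals all_analysis.
From mathcomp Require Import finmap complex ring lra.

Set Implicit Arguments.
Unset Strict Implicit.
Unset Printing Implicit Defensive.

Import Order.TTheory GRing.Theory Num.Theory numFieldNormedType.Exports.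

Local Open Scope classical_set_scope.
Local Open Scope ring_scope.
Local Open Scope complex_scope.

Notation normc := ComplexField.Normc.normc.

HB.instance Definition _ (R : rcfType) := NormedModule.copy R[i] R[i]^o.

Lemma normcC (R : rcfType) (z : R[i]) : `|z| = (normc z)%:C.
Proof. by case: z. Qed.

Lemma normc_ge0 (R : rcfType) (z : R[i]) : 0 <= normc z.
Proof. by rewrite -ler0c -normcC. Qed.

Lemma gt0C (R : rcfType) (e : R[i]) : 0 < e -> exists2 r : R, 0 < r & e = r%:C.
Proof.
case: e => a b; rewrite ltcE /= => /andP[/eqP -> a0].
by exists a.
Qed.

Section complex_complete.
Variable R : realType.

Lemma normc_Re_le (z : R[i]) : `|complex.Re z| <= normc z.
Proof. by rewrite -lecR -normcC; exact: normc_ge_Re. Qed.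

Lemma normc_Im_le (z : R[i]) : `|complex.Im z| <= normc z.
Proof.
case: z => a b /=; rewrite -sqrtr_sqr ler_sqrt ?addr_ge0 ?sqr_ge0//.
by rewrite lerDr sqr_ge0.
Qed.

Lemma normc_le_ReIm (z : R[i]) : normc z <= `|complex.Re z| + `|complex.Im z|.
Proof.
case: z => a b /=.
rewrite -[leRHS]ger0_norm ?addr_ge0// -sqrtr_sqr ler_wsqrtr// sqrrD.
by rewrite !real_normK ?num_real// lerD2r lerDl mulrn_wge0// mulr_ge0.
Qed.

Lemma complex_complete (F : set_system R[i]) :
  ProperFilter F -> cauchy F -> cvg F.
Proof.
move=> FF /cauchyP Fc.
have part (p : R[i] -> R) : (forall x y, `|p x - p y| <= normc (x - y)) ->
    cvg (p @ F).
  move=> lip; apply/cauchy_cvgP/cauchyP => e e0.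
  have [|x Fx] := Fc e%:C; first by rewrite ltcR.
  exists (p x); rewrite /nbhs/=; apply: filterS Fx => y.
  rewrite -!ball_normE /ball_/= normcC ltcR.
  exact: le_lt_trans.
have cRe : cvg (@complex.Re R @ F).
  apply: part => -[a b] [c d]; exact: (normc_Re_le ((a +i* b) - (c +i* d))).
have cIm : cvg (@complex.Im R @ F).
  apply: part => -[a b] [c d]; exact: (normc_Im_le ((a +i* b) - (c +i* d))).
move/cvg_ex: cRe => [a Fa]; move/cvg_ex: cIm => [b Fb].
apply/cvg_ex; exists (a +i* b); apply/cvgrPdist_lt => e /gt0C[r r0 ->].
have r20 : 0 < r / 2 by rewrite divr_gt0.
move/cvgrPdist_lt/(_ _ r20): Fa => Fa; move/cvgrPdist_lt/(_ _ r20): Fb => Fb.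
near=> z; rewrite normcC ltcR.
rewrite (le_lt_trans (normc_le_ReIm _))// [ltRHS](splitr r) ltrD//.
  by near: z; apply: filterS Fa => -[].
by near: z; apply: filterS Fb => -[].
Unshelve. all: by end_near. Qed.

HB.instance Definition _ := Uniform_isComplete.Build R[i] complex_complete.

End complex_complete.

Section measure_of_noncompactness.
Context {R : realType} {Y : completeNormedModType R[i]}.

(* In R[i], [0 <= k <= 1] forces [k] to be real, so [convex_set] is the usual
   notion of convexity of a complex vector space. *)
Definition convex_hull (A : set Y) : set Y := smallest (@convex_set _ Y) A.

Record measure_of_noncompactness (Om : set Y -> \bar R) : Prop := {
  mnc_ge0 : forall A, (0 <= Om A)%E ;
  mnc_compact : forall A, Om A = 0%E <-> compact (closure A) ;
  mnc_le : forall A B, A `<=` B -> (Om A <= Om B)%E ;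
  mnc_closure : forall A, Om (closure A) = Om A ;
  mnc_scale : forall A (l : R[i]),
    Om [set l *: x | x in A] = ((normc l)%:E * Om A)%E ;
  mnc_finite : forall A B, finite_set A -> A `&` B = set0 ->
    Om (A `|` B) = Om B ;
  mnc_convex_hull : forall A, Om (convex_hull A) = Om A }.

End measure_of_noncompactness.

Section bounded_continuous.
Variables (R : realType) (T : topologicalType).

Definition bounded_continuous : {pred T -> R[i]} :=
  [pred f | `[< continuous f /\ bounded_fun f >]].

Lemma bounded_continuousP (f : T -> R[i]) :
  f \in bounded_continuous <->
  continuous f /\ exists M : R, forall t, normc (f t) <= M.
Proof.
rewrite unfold_in /=; split.
  move=> /asboolP[cf [M [Mr fM]]]; split => //.
  move/complex_realP: Mr fM => [m ->] fM.
  exists (m + 1) => t; rewrite -lecR -normcC; apply: fM => //.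
  by rewrite ltcR ltrDl.
move=> [cf [M fM]]; apply/asboolP; split => //.
exists M%:C; split; first by apply/complex_realP; exists M.
move=> x Mx t _ /=; rewrite (le_trans _ (ltW Mx))//.
by rewrite normcC lecR.
Qed.

Lemma bounded_continuous_submod : submod_closed bounded_continuous.
Proof.
split.
  apply/bounded_continuousP; split; first by move=> x; exact: cvg_cst.
  by exists 0 => t; rewrite ComplexField.Normc.normc0.
move=> a f g /bounded_continuousP[cf [M fM]] /bounded_continuousP[cg [N gN]].
apply/bounded_continuousP; split.
  move=> x; apply: cvgD; last exact: cg.
  by apply: cvgZr; exact: cf.
exists (normc a * M + N) => t; rewrite -lecR -normcC.
rewrite (le_trans (ler_normD _ _))// rmorphD lerD//; last first.
  by rewrite normcC lecR.
by rewrite normrM !normcC -rmorphM lecR ler_wpM2l// normc_ge0.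
Qed.

HB.instance Definition _ := GRing.isSubmodClosed.Build R[i] (T -> R[i])
  bounded_continuous bounded_continuous_submod.

Record Cb := MkCb {
  Cb_fun :> T -> R[i] ;
  Cb_mem : Cb_fun \in bounded_continuous }.

HB.instance Definition _ := [isSub for Cb_fun].
HB.instance Definition _ := [Choice of Cb by <:].
HB.instance Definition _ := [SubChoice_isSubLmodule of Cb by <:].

Definition Cb_norm (f : Cb) : R[i] := (sup (range (fun t => normc (f t))))%:C.

Lemma le_Cb_norm (f : Cb) t : `|f t| <= Cb_norm f.
Proof.
have /bounded_continuousP[_ [M fM]] := Cb_mem f.
rewrite normcC lecR; apply: ub_le_sup; last by exists t.
by exists M => _ [s _ <-]; exact: fM.
Qed.

Lemma Cb_norm_le (f : Cb) (c : R) :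
  0 <= c -> (forall t, `|f t| <= c%:C) -> Cb_norm f <= c%:C.
Proof.
move=> c0 fc; rewrite lecR.
have [->|/set0P ne] := eqVneq (range (fun t => normc (f t))) set0.
  by rewrite sup0.
by apply: ge_sup => // _ [t _ <-]; rewrite -lecR -normcC.
Qed.

Lemma Cb_norm_ge0 (f : Cb) : 0 <= Cb_norm f.
Proof.
have [r0|/set0P [_ [t _ _]]] := eqVneq (range (fun t => normc (f t))) set0.
  by rewrite /Cb_norm r0 sup0.
exact: le_trans (le_Cb_norm f t).
Qed.

Lemma Cb_norm_normc (f : Cb) : Cb_norm f = (normc (Cb_norm f))%:C.
Proof. by rewrite -normcC ger0_norm// Cb_norm_ge0. Qed.

Lemma Cb_normD (f g : Cb) : Cb_norm (f + g) <= Cb_norm f + Cb_norm g.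
Proof.
rewrite (Cb_norm_normc f) (Cb_norm_normc g) -rmorphD.
apply: Cb_norm_le => [|t]; first by rewrite addr_ge0// normc_ge0.
rewrite rmorphD/= -!Cb_norm_normc (le_trans (ler_normD _ _))//.
by rewrite lerD// le_Cb_norm.
Qed.

Lemma Cb_normZ_le (l : R[i]) (f : Cb) : Cb_norm (l *: f) <= `|l| * Cb_norm f.
Proof.
rewrite (Cb_norm_normc f) normcC -rmorphM.
apply: Cb_norm_le => [|t]; first by rewrite mulr_ge0// normc_ge0.
by rewrite rmorphM/= -Cb_norm_normc -normcC normrM ler_wpM2l// le_Cb_norm.
Qed.

Lemma Cb_normZ (l : R[i]) (f : Cb) : Cb_norm (l *: f) = `|l| * Cb_norm f.
Proof.
apply/eqP; rewrite eq_le Cb_normZ_le/=.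
have [->|l0] := eqVneq l 0.
  by rewrite normr0 mul0r Cb_norm_ge0.
rewrite -ler_pdivlMl ?normr_gt0//.
by rewrite -normfV -[X in Cb_norm X <= _](scalerK l0) Cb_normZ_le.
Qed.

Lemma Cb_norm0 (f : Cb) : Cb_norm f = 0 -> f = 0.
Proof.
move=> f0; apply: val_inj; apply/funext => t; apply/eqP.
by rewrite -normr_le0 -f0; exact: le_Cb_norm.
Qed.

HB.instance Definition _ := Lmodule_isNormed.Build R[i] Cb
  Cb_normD Cb_normZ Cb_norm0.

Lemma Cb_complete (F : set_system Cb) : ProperFilter F -> cauchy F -> cvg F.
Proof.
move=> FF /cauchyP Fc.
have ptw (t : T) : cvg (f t @[f --> F]).
  apply/cauchy_cvgP/cauchyP => e e0.
  have [f Ff] := Fc e e0; exists (f t); rewrite /nbhs/=; apply: filterS Ff => g.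
  rewrite -!ball_normE /ball_/=; apply: le_lt_trans.
  exact: (le_Cb_norm (f - g) t).
pose g t : R[i] := lim (f t @[f --> F]).
have unif (e : R) : 0 < e ->
    exists2 f : Cb, F (ball f e%:C) & forall t, `|f t - g t| <= e%:C.
  move=> e0; have [|f Ff] := Fc e%:C; first by rewrite ltcR.
  exists f => // t.
  apply/ler_addgt0Pl => d /gt0C[r r0 ->].
  have near1 : F [set h : Cb | `|g t - h t| < r%:C].
    by move/cvgrPdist_lt: (ptw t) => /(_ r%:C); apply; rewrite ltcR.
  have [h [/= fh gh]] := filter_ex (filterI Ff near1).
  have -> : f t - g t = (h t - g t) + (f t - h t) by rewrite [RHS]addrC subrKA.
  rewrite (le_trans (ler_normD _ _))// lerD//; first by rewrite distrC ltW.
  move: fh; rewrite -ball_normE /ball_/= => /ltW; apply: le_trans.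
  exact: (le_Cb_norm (f - h) t).
have gP : g \in bounded_continuous.
  apply/bounded_continuousP; split.
    move=> t; apply/cvgrPdist_lt => e /gt0C[r r0 ->].
    have r30 : 0 < r / 3 by rewrite divr_gt0.
    have [f _ fg] := unif _ r30.
    have /bounded_continuousP[/(_ t)/cvgrPdist_lt/(_ (r / 3)%:C) cf _] :=
      Cb_mem f.
    have {}cf : \forall s \near t, `|f t - f s| < (r / 3)%:C.
      by apply: cf; rewrite ltcR.
    near=> s.
    have -> : g t - g s = (g t - f t) + (f t - f s) + (f s - g s).
      by rewrite !subrKA.
    have -> : r%:C = (r / 3)%:C + (r / 3)%:C + (r / 3)%:C.
      by rewrite -!rmorphD; congr (_%:C); lra.
    rewrite (le_lt_trans (ler_normD _ _))// ltr_leD//.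
    rewrite (le_lt_trans (ler_normD _ _))// ler_ltD//.
      by rewrite distrC.
    by near: s.
  have [f _ fg] := unif 1 ltr01.
  have /bounded_continuousP[_ [M fM]] := Cb_mem f.
  exists (1 + M) => t; rewrite -lecR -normcC.
  rewrite -[g t](subrK (f t)) (le_trans (ler_normD _ _))// rmorphD.
  by rewrite lerD// 1?distrC// normcC lecR.
apply/cvg_ex; exists (MkCb gP); apply/cvgrPdist_lt => e /gt0C[r r0 ->].
have r30 : 0 < r / 3 by rewrite divr_gt0.
have [f Ff fg] := unif _ r30.
apply: filterS Ff => h; rewrite -ball_normE /ball_/= => fh.
have -> : MkCb gP - h = (MkCb gP - f) + (f - h) by rewrite subrKA.
have -> : r%:C = (r / 3 + r / 3)%:C + (r / 3)%:C.
  by rewrite -!rmorphD; congr (_%:C); lra.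
rewrite (le_lt_trans (ler_normD _ _))// ler_ltD//.
apply: Cb_norm_le => [|t]; first by rewrite addr_ge0// ltW.
rewrite rmorphD (le_trans (_ : _ <= (r / 3)%:C))//; last first.
  by rewrite lerDl lecR ltW.
by rewrite distrC; exact: fg.
Unshelve. all: by end_near. Qed.

HB.instance Definition _ := Uniform_isComplete.Build Cb Cb_complete.

End bounded_continuous.

Section wallman.
Variables (R : realType) (T : topologicalType).
Implicit Types (U V Z : set T) (f g : Cb R T).

Definition zero_set Z : Prop := exists f : Cb R T, Z = f @^-1` [set 0].

Lemma Cb_mul_subproof f g : (fun t => f t * g t) \in @bounded_continuous R T.
Proof.
have /bounded_continuousP[cf [M fM]] := Cb_mem f.
have /bounded_continuousP[cg [N gN]] := Cb_mem g.
apply/bounded_continuousP; split.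
  by move=> t; apply: cvgM; [exact: cf|exact: cg].
exists (M * N) => t; rewrite ComplexField.Normc.normcM.
by apply: ler_pM => //; exact: normc_ge0.
Qed.

Lemma Cb_cst_subproof (c : R[i]) : (fun _ => c) \in @bounded_continuous R T.
Proof.
apply/bounded_continuousP; split; first by move=> t; exact: cvg_cst.
by exists (normc c).
Qed.

Lemma zero_setU Z1 Z2 : zero_set Z1 -> zero_set Z2 -> zero_set (Z1 `|` Z2).
Proof.
move=> [f ->] [g ->]; exists (MkCb (Cb_mul_subproof f g)).
apply/seteqP; split=> t /=.
  by case=> ->; rewrite ?mul0r ?mulr0.
by move/eqP; rewrite mulf_eq0 => /orP[] /eqP; [left|right].
Qed.

(* [finI F id]: every finite subfamily of F has a nonempty intersection. *)
Definition omega_ultrafilter (F : set (set T)) : Prop :=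
  [/\ F `<=` zero_set, finI F id &
      forall Z, zero_set Z -> finI (F `|` [set Z]) id -> F Z].

Record Wall := MkWall {
  Wall_family : set (set T) ;
  Wall_ultra : omega_ultrafilter Wall_family }.

HB.instance Definition _ := gen_eqMixin Wall.
HB.instance Definition _ := gen_choiceMixin Wall.

Definition wall_star U : set Wall := [set W : Wall | ~ Wall_family W (~` U)].

Lemma Wall_not0 (W : Wall) : ~ Wall_family W set0.
Proof.
case: W => F [_ FI _] /= F0.
have [|t] := FI [fset set0]%fset.
  by move=> A; rewrite inE => /eqP ->; exact: mem_set.
by move=> /(_ set0); apply; rewrite /= inE.
Qed.

Lemma WallP (W : Wall) Z : zero_set Z -> ~ Wall_family W Z ->
  exists2 D : {fset set T}, {subset D <= Wall_family W} &
    forall t, (forall A, A \in D -> A t) -> ~ Z t.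
Proof.
case: W => F [Fz FI Fmax] /= zZ nFZ; apply: contrapT => H; apply: nFZ.
apply: Fmax => // D DF.
have [t Dt] : exists t, (forall A, A \in D -> A != Z -> A t) /\ Z t.
  apply: contrapT => nt; apply: H.
  exists [fset A in D | A != Z]%fset.
    move=> A; rewrite !inE/= => /andP[AD AZ].
    have /set_mem[|/= AeZ] := DF A AD; first exact: mem_set.
    by move: AZ; rewrite AeZ eqxx.
  move=> t tD Zt; apply: nt; exists t; split => // A AD AZ.
  by apply: tD; rewrite !inE AD.
exists t => A /= AD; have [->|AZ] := eqVneq A Z; first exact: Dt.2.
exact: Dt.1.
Qed.

Lemma Wall_prime (W : Wall) Z1 Z2 : zero_set Z1 -> zero_set Z2 ->
  Wall_family W (Z1 `|` Z2) -> Wall_family W Z1 \/ Wall_family W Z2.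
Proof.
move=> z1 z2 W12; apply: contrapT => /not_orP[/(WallP z1)[D1 sD1 D1Z]].
move=> /(WallP z2)[D2 sD2 D2Z].
have [_ WI _] := Wall_ultra W.
pose Z12 : set T := Z1 `|` Z2.
have [|t Dt] := WI (D1 `|` D2 `|` [fset Z12])%fset.
  move=> A; rewrite !inE => /orP[/orP[/sD1|/sD2]|/eqP ->] //.
  exact: mem_set.
have : Z12 t by apply: Dt; rewrite /= !inE eqxx orbT.
case; [apply: D1Z|apply: D2Z] => A AD; apply: Dt; rewrite /= !inE AD ?orbT//.
Qed.

Lemma wall_star_cover : \bigcup_(U in open) wall_star U = setT.
Proof.
apply/seteqP; split => // W _; exists setT; first exact: openT.
by rewrite /wall_star /= setCT; exact: Wall_not0.
Qed.

Lemma wall_star_join U V (W : Wall) : open U -> open V ->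
  wall_star U W -> wall_star V W ->
  exists O, [/\ open O, wall_star O W & wall_star O `<=` wall_star U `&` wall_star V].
Proof.
have starT O : ~ zero_set (~` O) -> forall W', wall_star O W'.
  by move=> nz W' WO; apply: nz; have [+ _ _] := Wall_ultra W'; apply.
move=> oU oV WU WV.
have [zU|/starT sU] := pselect (zero_set (~` U)); last by exists V; split.
have [zV|/starT sV] := pselect (zero_set (~` V)); last by exists U; split.
exists (U `&` V); split; first exact: openI.
  by rewrite /wall_star /= setCI => /(Wall_prime zU zV)[].
move=> W' WO.
suff up Z Z' : zero_set Z' -> Z `<=` Z' -> Wall_family W' Z -> Wall_family W' Z'.
  by split => WO'; apply: WO; (apply: up WO';
    [rewrite setCI; exact: zero_setU|apply: subsetC => x []]).
move=> zZ' ZZ' WZ; apply: contrapT => /(WallP zZ')[D sD DZ].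
have [_ WI _] := Wall_ultra W'.
have [|t Dt] := WI (Z |` D)%fset.
  by move=> A; rewrite !inE => /orP[/eqP ->|/sD//]; exact: mem_set.
apply: (DZ t); first by move=> A AD; apply: Dt; rewrite /= !inE AD orbT.
by apply: ZZ'; apply: Dt; rewrite /= !inE eqxx.
Qed.

HB.instance Definition _ :=
  isBaseTopological.Build Wall wall_star_cover wall_star_join.

Definition wall_point_family (t : T) : set (set T) :=
  [set Z | exists2 f : Cb R T, Z = f @^-1` [set 0] & f t = 0].

Lemma wall_point_ultra t : omega_ultrafilter (wall_point_family t).
Proof.
split.
- by move=> Z [f -> _]; exists f.
- by move=> D DF; exists t => A /= /DF /set_mem[f -> ft].
- move=> Z [f ->] FI; exists f => //; apply: contrapT => ft0.
  pose g : Cb R T := f - MkCb (Cb_cst_subproof (f t)).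
  pose D := [fset f @^-1` [set 0]; g @^-1` [set 0]]%fset.
  have [|s Ds] := FI D.
    move=> A; rewrite !inE => /orP[|] /eqP ->; apply: mem_set; [by right|left].
    by exists g => //; exact: (subrr (f t)).
  have fs : f s = 0 by apply: (Ds (f @^-1` [set 0])); rewrite /= !inE eqxx.
  have gs : f s - f t = 0
    by apply: (Ds (g @^-1` [set 0])); rewrite /= !inE eqxx orbT.
  by apply: ft0; move/eqP: gs; rewrite fs sub0r oppr_eq0 => /eqP.
Qed.

Definition wall_point (t : T) : Wall := MkWall (wall_point_ultra t).

(* [gelfand f] is the continuous extension of [f] to [Wall],
   which is unique since the range of [wall_point] is dense. *)
Definition gelfand f : Wall -> R[i] :=
  xget (fun _ => 0)
    [set h | continuous h /\ forall t, h (wall_point t) = f t].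

Local Open Scope ereal_scope.

(* Supremum in [0, +oo], so that the supremum of an empty family is 0. *)
Definition sup_nneg (I : Type) (D : set I) (F : I -> \bar R) : \bar R :=
  ereal_sup ([set 0] `|` [set F i | i in D]).

Definition eta (xi : set R[i] -> \bar R) (F : set (Cb R T)) : \bar R :=
  sup_nneg [set: T] (fun t => xi [set f t | f in F]).

(* If [~` V] is not a zero set, then no ω-ultrafilter contains [~` V] and
   [wall_star V] is all of [Wall]: such a [V] contributes nothing to the
   topology of [Wall] but need not be the trace of a neighborhood of [W]. Hence
   the infimum is over the open [V] whose complement is a zero set. *)
Definition omega (F : set (Cb R T)) : \bar R :=
  sup_nneg [set: Wall] (fun W =>
    ereal_inf [set sup_nneg F (fun f => sup_nneg V (fun t =>
                     (normc (gelfand f W - f t)%R)%:E))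
              | V in [set V | [/\ open V, zero_set (~` V) & wall_star V W]]]).

Definition Omega (xi : set R[i] -> \bar R) (F : set (Cb R T)) : \bar R :=
  omega F + eta xi F.

End wallman.

(* Main.v *)
Require Import Defs.
From mathcomp Require Import all_boot all_order all_algebra.
From mathcomp Require Import all_classical all_reals all_analysis.
From mathcomp Require Import complex.
From mathcomp Require Import finmap lra.

(** The functional [Omega] splits as [omega + eta]; each summand is shown to be
    monotone, compatible with scaling, and invariant under closure, convex hull
    and union with a finite set, and the two together detect relative
    compactness.

    Everything about [omega] is read off a filter on [T]. For an ultrafilter
    [W] of zero sets, the open sets [V] admitted in the infimum form the base of
    a proper filter [wall_filter W] (the trace on [T] of the neighborhoods of
    [W]). Each bounded continuous [f] converges along it: its range is bounded,
    so it has a cluster point [c], and a member of [W] on which [f] stays away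
    from [c] would keep [f] away from [c] along the whole filter. Hence [f]
    extends continuously to [Wall], and conversely the limit of [f] along
    [wall_filter W] is the value at [W] of any continuous extension
    ([gelfand_cvg]). Linearity and the bound
    [|gelfand f W - gelfand g W| <= |f - g|] follow by passing to the limit.
    For real [c >= 0], the bound [omega F <= c] then says that for every [W] and
    [e > 0], eventually along [wall_filter W], all [f] in [F] satisfy
    [|gelfand f W - f t| <= c + e] ([omegaP]). In this form the inequalities
    between values of [omega] are manipulations of norms.

    For relative compactness, one direction holds because a compact family is
    equicontinuous at each [W] ([compact_oscillation]) and its set of values at
    each point is compact. For the other ([compact_of_oscillation]), suppose
    that [omega F = 0]. Choose for each [W] an admissible [V W] on which every
    [f] in [F] is within [e] of [gelfand f W]. Finitely many [V W] cover [T]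
    ([wall_finite_cover]): otherwise their complements would be a family of zero
    sets with the finite intersection property, contained by the lemma of Zorn
    in some [W], against the admissibility of [V W]. On each of these finitely
    many pieces every [f] in [F] is almost constant, and its values at one point
    of the piece lie in a compact set, since [eta F = 0]. So every ultrafilter
    containing [F] is Cauchy, and completeness of the space of bounded
    continuous functions concludes. *)

Set Implicit Arguments.
Unset Strict Implicit.
Unset Printing Implicit Defensive.

Import Order.TTheory GRing.Theory Num.Theory numFieldNormedType.Exports.

Local Open Scope classical_set_scope.
Local Open Scope ring_scope.
Local Open Scope complex_scope.
Local Open Scope convex_scope.

(** * Limits in normed spaces and in the complex numbers *)

Lemma near_dist_lt (K : numFieldType) (V : normedModType K) (x : V) (e : K) :
  0 < e -> \forall y \near x, `|x - y| < e.
Proof. by move=> /(near_ball x); rewrite -ball_normE. Qed.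

Lemma normc_distC (R : realType) (z w : R[i]) : normc (z - w) = normc (w - z).
Proof. by apply: complexI; rewrite -!normcC distrC. Qed.

Lemma normc_continuous (R : realType) : continuous (@normc R).
Proof.
move=> z; have FF : Filter (nbhs z) by exact: nbhs_filter.
apply/cvgrPdist_le => e e0.
have ep : 0 < e%:C by rewrite ltcR.
apply: filterS (near_dist_lt z ep) => w; rewrite normcC ltcR => /ltW.
apply: le_trans.
have tri (x y : R[i]) : normc x <= normc y + normc (x - y).
  rewrite -lecR rmorphD/= -!normcC -[X in `|X| <= _](subrK y) addrC.
  exact: ler_normD.
rewrite ler_norml; move: (tri z w) (tri w z).
by rewrite (normc_distC w) => h1 h2; lra.
Qed.

Lemma real_complex_continuous (R : realType) :
  continuous (fun x : R => x%:C : R[i]).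
Proof.
move=> x; apply/cvgrPdist_lt => e /gt0C[r r0 ->].
apply: filterS (near_dist_lt x r0) => y.
by rewrite -rmorphB normcC ltcR /= expr0n/= addr0 sqrtr_sqr.
Qed.

(** Transfers compactness of a square of the real plane to the complex plane. *)
Lemma pair_complex_continuous (R : realType) :
  continuous (fun p : R * R => p.1 +i* p.2 : R[i]).
Proof.
move=> p; apply/cvgrPdist_le => e /gt0C[r r0 ->].
have r20 : 0 < r / 2 by rewrite divr_gt0.
have c1 : \forall q \near p, `|p.1 - q.1| < r / 2.
  exact: (cvg_fst (near_dist_lt p.1 r20)).
have c2 : \forall q \near p, `|p.2 - q.2| < r / 2.
  exact: (cvg_snd (near_dist_lt p.2 r20)).
near=> q; rewrite normcC lecR (le_trans (normc_le_ReIm _))//.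
by rewrite (splitr r) lerD//= ltW//; near: q.
Unshelve. all: by end_near. Qed.

Lemma compact_normc_le (R : realType) (M : R) :
  compact [set z : R[i] | normc z <= M].
Proof.
have cb : compact ((fun p : R * R => p.1 +i* p.2 : R[i]) @`
    (`[- M, M]%classic `*` `[- M, M]%classic)).
  apply: continuous_compact; last first.
    by apply: compact_setX; exact: segment_compact.
  exact/continuous_subspaceT/pair_complex_continuous.
apply: subclosed_compact cb _ => [|[a b] zM].
  rewrite -[X in closed X]/(@normc R @^-1` [set x | x <= M]).
  apply: closed_comp; last exact: closed_le.
  by move=> z _; exact: normc_continuous.
exists (a, b) => //; split => /=; rewrite in_itv/= -ler_norml.
- exact: le_trans (normc_Re_le (a +i* b)) _.
- exact: le_trans (normc_Im_le (a +i* b)) _.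
Qed.

Lemma ball_complexE (R : realType) (z w : R[i]) (e : R) :
  ball z e%:C w <-> normc (z - w) < e.
Proof. by rewrite -ball_normE /ball_/= normcC ltcR. Qed.

Lemma cvg_dist_le (K : numFieldType) (V : normedModType K) (S : Type)
    (F : set_system S) (FF : ProperFilter F) (f : S -> V) (a c : V) (e : K) :
  f @ F --> a -> (\forall t \near F, `|c - f t| <= e) -> `|c - a| <= e.
Proof.
move=> fa fc; apply/ler_addgt0Pl => d d0.
have [t [ft fct]] := filter_ex (filterI (cvgr_distC_lt _ _ fa _ d0) fc).
rewrite -(subrKA (f t)) addrC (le_trans (ler_normD _ _))// lerD//.
exact: ltW.
Qed.

(** * The trace on [T] of the neighborhoods of a point of [Wall] *)

Section wall_filter.
Context {R : realType} {T : topologicalType}.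
Implicit Types (W : Wall R T) (f g : Cb R T) (V Z : set T).

(** Truncating [g] to the interval [0, 1] gives a bounded function with these
    zeros, so sublevel sets of unbounded continuous functions are zero sets
    too. *)
Lemma zero_set_le (g : T -> R) : continuous g -> zero_set R [set t | g t <= 0].
Proof.
move=> gc; pose h t : R[i] := (Num.min 1 (Num.max 0 (g t)))%:C.
have hb : h \in @bounded_continuous R T.
  apply/bounded_continuousP; split.
    move=> t.
    apply: (@continuous_comp _ _ _ (fun t => Num.min 1 (Num.max 0 (g t)))).
      apply: continuous_min; first exact: cvg_cst.
      by apply: continuous_max; [exact: cvg_cst|exact: gc].
    exact: real_complex_continuous.
  exists 1 => t; rewrite -lecR -normcC.
  rewrite ger0_norm lecR ?le_min ?ler01 ?le_max ?lexx//.
  by rewrite ge_min lexx.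
exists (MkCb hb); apply/seteqP; split => t /=.
  by move=> gt0; congr (_%:C); rewrite max_l// min_r.
move=> /complexI; case: (leP (g t) 0) => // gt.
by case: leP => // _ /eqP; rewrite ?oner_eq0// gt_eqF.
Qed.

Lemma zero_setT : zero_set R [set: T].
Proof.
by exists 0; apply/seteqP; split.
Qed.

Lemma zero_set0 : zero_set R (@set0 T).
Proof.
exists (MkCb (Cb_cst_subproof T 1)); apply/seteqP; split => //= t /eqP.
by rewrite oner_eq0.
Qed.

Lemma dist_continuous f (c : R[i]) : continuous (fun t => normc (f t - c)).
Proof.
have /bounded_continuousP[cf _] := Cb_mem f.
move=> t; apply: (@continuous_comp _ _ _ (fun t => f t - c)).
  by apply: cvgB; [exact: cf|exact: cvg_cst].
exact: normc_continuous.
Qed.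

Lemma WallT W : Wall_family W [set: T].
Proof.
apply: contrapT => /(WallP zero_setT)[D sD DT].
have [_ FI _] := Wall_ultra W; have [//|t tD] := FI D.
by apply: (DT t) => // A AD; exact: tD.
Qed.

Lemma Wall_disjoint W Z Z' : Wall_family W Z -> Z `&` Z' = set0 ->
  ~ Wall_family W Z'.
Proof.
move=> WZ ZZ' WZ'; have [_ FI _] := Wall_ultra W.
have [|t Dt] := FI [fset Z; Z']%fset.
  by move=> A; rewrite !inE => /orP[] /eqP ->; exact: mem_set.
suff : (Z `&` Z') t by rewrite ZZ'.
by split; apply: Dt; rewrite /= !inE eqxx ?orbT.
Qed.

Definition wall_base W : set (set T) :=
  [set V | [/\ open V, zero_set R (~` V) & wall_star V W]].

Definition wall_filter W : set_system T := filter_from (wall_base W) id.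

Lemma wall_baseT W : wall_base W setT.
Proof.
split; first exact: openT.
- by rewrite setCT; exact: zero_set0.
- by rewrite /wall_star/= setCT; exact: Wall_not0.
Qed.

Global Instance wall_filter_proper W : ProperFilter (wall_filter W).
Proof.
apply: filter_from_proper.
  apply: filter_from_filter; first by exists setT; exact: wall_baseT.
  move=> U V [oU zU sU] [oV zV sV]; exists (U `&` V) => //; split.
  - exact: openI.
  - by rewrite setCI; exact: zero_setU.
  - by rewrite /wall_star/= setCI => /(Wall_prime zU zV)[].
move=> V [_ _ sV]; apply/set0P/eqP => V0; apply: sV.
by rewrite V0 setC0; exact: WallT.
Qed.

(** The cozero set of the positive part of [g] is admissible as soon as its
    complement escapes [W]. *)
Lemma wall_filter_lt W (g : T -> R) : continuous g ->
  ~ Wall_family W [set t | g t <= 0] -> \forall t \near wall_filter W, 0 < g t.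
Proof.
move=> gc nW; have E : ~` [set t | 0 < g t] = [set t | g t <= 0].
  by apply/seteqP; split => t /=; rewrite leNgt => /negP.
exists [set t | 0 < g t] => //; split.
- apply: (@open_comp _ _ g [set x | 0 < x]) => [t _|]; first exact: gc.
  exact: open_gt.
- by rewrite E; exact: zero_set_le.
- by rewrite /wall_star/= E.
Qed.

(** Let [c] be a cluster point of [f]. If the zero set [|f - c| >= e] were in
    [W], the disjoint zero set [|f - c| <= e / 2] would not be, so that
    eventually [|f - c| > e / 2], and [c] would not be a cluster point. Hence
    [|f - c| < e] eventually. *)
Lemma wall_filter_cvg W f : exists c : R[i], f @ wall_filter W --> c.
Proof.
have /bounded_continuousP[cf [M fM]] := Cb_mem f.
have [|c [_ clc]] := @compact_normc_le R M (f @ wall_filter W) _.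
  by apply: (@filterE _ (wall_filter W)) => t; exact: fM.
exists c; apply/cvgrPdist_lt => _ /gt0C[e e0 ->].
have e20 : 0 < e / 2 by rewrite divr_gt0.
have cd := @dist_continuous f c.
have far_lt : \forall t \near wall_filter W, 0 < e - normc (f t - c).
  apply: wall_filter_lt => [|Wfar].
    by move=> t; apply: cvgB; [exact: cvg_cst|exact: cd].
  have close_gt : \forall t \near wall_filter W, 0 < normc (f t - c) - e / 2.
    apply: wall_filter_lt => [|].
      by move=> t; apply: cvgB; [exact: cd|exact: cvg_cst].
    apply: Wall_disjoint Wfar _; apply/seteqP; split => // t [] /=.
    by move=> h1 h2; lra.
  have bc : nbhs c (ball c (e / 2)%:C) by apply: nbhsx_ballx; rewrite ltcR.
  have [z [/= + /ball_complexE]] :=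
    clc [set z | 0 < normc (z - c) - e / 2] _ close_gt bc.
  by rewrite normc_distC => h1 h2; lra.
apply: filterS far_lt => t; rewrite subr_gt0 normc_distC.
by rewrite normcC ltcR.
Qed.

(** The complement of an admissible set is a zero set, so if it contained [t] it
    would belong to the ultrafilter of [t]. *)
Lemma wall_filter_point (t : T) (A : set T) :
  wall_filter (wall_point R t) A -> A t.
Proof.
move=> [V [_ [f fV] sV]]; apply; apply: contrapT => nVt; apply: sV => /=.
by exists f => //; have : (~` V) t by []; rewrite fV.
Qed.

Lemma nbhs_wall_star V W : open V -> wall_star V W -> nbhs W (wall_star V).
Proof.
move=> oV sV; rewrite nbhsE; exists (wall_star V) => //; split => //.
by exists [set V]; [move=> _ ->|rewrite bigcup_set1].
Qed.

(** The extension by limits is continuous because an admissible [V] for [W] is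
    admissible for every [W'] in [wall_star V], so that a bound valid on [V]
    passes to the limit at all these [W']. This shows that the choice made in
    [gelfand] is not the default one. *)
Lemma gelfand_spec f :
  continuous (gelfand f) /\ forall t, gelfand f (wall_point R t) = f t.
Proof.
rewrite /gelfand; case: xgetP => [h _ //|]; apply: contraPP => _.
have [h hP] := choice (fun W => wall_filter_cvg W f).
move/(_ h); apply; split => [W|t].
  have FF : Filter (nbhs W) by exact: nbhs_filter.
  apply/cvgrPdist_le => e e0.
  have [V [oV zV sV] fV] : \forall t \near wall_filter W, `|h W - f t| < e.
    exact: cvgr_dist_lt.
  apply: filterS (nbhs_wall_star oV sV) => W' sV'.
  apply: cvg_dist_le (hP W') _.
  by exists V => // t /fV/ltW.
apply/eqP; rewrite -subr_eq0 -normr_le0; apply/ler_addgt0Pl => e e0.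
rewrite addr0.
exact: (wall_filter_point (cvgr_dist_le _ _ (hP (wall_point R t)) _ e0)).
Qed.

(** The argument applies to every continuous extension of [f]. A basic
    neighborhood [wall_star U] of [W] contains the image of [U]; it yields a
    member of the filter when the complement of [U] is a zero set. Otherwise
    [wall_star U] is the whole of [Wall], and the estimate holds on all of
    [T]. *)
Lemma gelfand_cvg f W : f @ wall_filter W --> gelfand f W.
Proof.
have [cg gE] := gelfand_spec f.
apply/cvgrPdist_lt => e e0.
have : nbhs W [set W' | `|gelfand f W - gelfand f W'| < e].
  have FF : Filter (nbhs W) by exact: nbhs_filter.
  exact: (@cvgr_dist_lt _ _ _ _ FF _ _ (cg W) _ e0).
rewrite nbhsE => -[B [[D Dop <-] [U DU UW]] Be].
have oU : open U by exact: Dop.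
have [zU|nzU] := pselect (zero_set R (~` U)).
  exists U; first by split.
  move=> t Ut /=; rewrite -gE; apply: Be; exists U => //.
  move=> [g gU gt]; have : (~` U) t by rewrite gU.
  by apply.
apply: filterE => t; rewrite -gE; apply: Be; exists U => //.
by move=> WU; apply: nzU; have [+ _ _] := Wall_ultra (wall_point R t); apply.
Qed.

Lemma gelfand_linear (a b : R[i]) f g W :
  gelfand (a *: f + b *: g) W = a * gelfand f W + b * gelfand g W.
Proof.
have fgc : (a *: f + b *: g) @ wall_filter W -->
    a * gelfand f W + b * gelfand g W.
  apply: (@cvgD _ R[i] _ _ _ (fun t => a * f t) (fun t => b * g t)).
    by apply: cvgZr; exact: gelfand_cvg.
  by apply: cvgZr; exact: gelfand_cvg.
have h := @gelfand_cvg (a *: f + b *: g) W.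
by apply: (cvg_unique _ h fgc); exact: norm_hausdorff.
Qed.

Lemma gelfand_dist f g W : `|gelfand f W - gelfand g W| <= `|f - g|.
Proof.
have -> : gelfand f W - gelfand g W = gelfand (f - g) W.
  have := gelfand_linear 1 (-1) f g W.
  by rewrite scale1r scaleN1r mul1r mulN1r.
rewrite -normrN -sub0r; apply: cvg_dist_le (@gelfand_cvg (f - g) W) _.
by apply: filterE => t; rewrite sub0r normrN; exact: le_Cb_norm.
Qed.
End wall_filter.

(** * Compactness of [Wall] *)

Section finite_cover.
Context {R : realType} {T : topologicalType}.

(** A finite part of [\bigcup_(G in C) G `|` E] takes its elements outside [E]
    from finitely many members of the chain [C], hence lies in [G `|` E] for the
    largest of them, or in [E] if there are none. This is the chain condition
    for the lemma of Zorn. *)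
Lemma finI_chain (X : choiceType) (E : set (set X)) (C : set (set (set X))) :
  total_on C subset -> finI E id -> (forall G, C G -> finI (G `|` E) id) ->
  finI (\bigcup_(G in C) G `|` E) id.
Proof.
move=> Ct EI CI D sD.
have sub (s : seq (set X)) :
    (forall A, A \in s -> (\bigcup_(G in C) G `|` E) A) ->
    (forall A, A \in s -> E A) \/
    exists2 G, C G & forall A, A \in s -> (G `|` E) A.
  elim: s => [|A s IH] sA; first by left.
  have [|sE|[G CG sG]] := IH.
  - by move=> B Bs; apply: sA; rewrite inE Bs orbT.
  - have [[G CG GA]|EA] := sA A (mem_head _ _).
      right; exists G => // B; rewrite in_cons => /orP[/eqP ->|/sE EB].
        by left.
      by right.
    by left => B; rewrite in_cons => /orP[/eqP ->|/sE].
  right; have [[H CH HA]|EA] := sA A (mem_head _ _); last first.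
    by exists G => // B; rewrite in_cons => /orP[/eqP ->|/sG//]; right.
  have [GH|HG] := Ct _ _ CG CH.
    exists H => // B; rewrite in_cons => /orP[/eqP ->|/sG[/GH|]]; first by left.
      by left.
    by right.
  exists G => // B; rewrite in_cons => /orP[/eqP ->|/sG//].
  by left; exact: HG.
have [A /sD/set_mem//|sE|[G CG sG]] := sub D.
  by apply: EI => A /sE/mem_set.
by apply: (CI G CG) => A /sG/mem_set.
Qed.

(** Maximality is sought among the families [G] for which [G `|` E], and not
    merely [G], has the finite intersection property: the empty chain is then
    harmless, and a maximal such family automatically contains [E]. *)
Lemma Wall_extend (E : set (set T)) : E `<=` zero_set R (T:=T) -> finI E id ->
  exists W : Wall R T, E `<=` Wall_family W.
Proof.
move=> Ez EI.
pose P (G : set (set T)) := G `<=` zero_set R (T:=T) /\ finI (G `|` E) id.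
have [C CP Ct|F [[Fz FI] Fmax]] := @Zorn_bigcup _ P.
  split; first by move=> A [G /CP[Gz _] /Gz].
  by apply: finI_chain => // G /CP[].
have EF : E `<=` F.
  apply: contrapT => nEF; apply: (Fmax (F `|` E)).
    split; [exact: subsetUl|by move=> h; apply: nEF => A EA; apply: h; right].
  split; last by rewrite -setUA setUid.
  by move=> A [/Fz|/Ez].
have Fu : omega_ultrafilter R F.
  split => //.
    by move=> D sD; apply: FI => A /sD/set_mem FA; apply/mem_set; left.
  move=> Z zZ ZI; apply: contrapT => nFZ; apply: (Fmax (F `|` [set Z])).
    split; [exact: subsetUl|by move=> h; apply: nFZ; apply: h; right].
  split; first by move=> A [/Fz|->].
  move=> D sD; apply: ZI => A /sD/set_mem[|/EF FA]; apply/mem_set => //.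
  by left.
by exists (MkWall Fu).
Qed.

(** If no finitely many of the [V W] covered [T], their complements would all
    belong to some [W], and in particular [~` V W] would. *)
Lemma wall_finite_cover (V : Wall R T -> set T) :
  (forall W, wall_base W (V W)) ->
  exists s : seq (Wall R T), forall t, exists2 W, W \in s & V W t.
Proof.
move=> Vb; apply: contrapT => nV.
have [|D sD|W WE] := @Wall_extend [set ~` V W | W in [set: Wall R T]].
- by move=> _ [W _ <-]; have [] := Vb W.
- have [s sP] : exists s : seq (Wall R T),
      forall A, A \in (D : seq _) -> exists2 W, W \in s & A = ~` V W.
    have {}sD : {subset (D : seq _) <= [set ~` V W | W in [set: Wall R T]]}.
      by [].
    elim: (D : seq _) sD => [|A l IH] sl; first by exists [::].
    have [|s sP] := IH; first by move=> B Bl; apply: sl; rewrite inE Bl orbT.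
    have /set_mem[W _ WA] := sl A (mem_head _ _).
    exists (W :: s) => B; rewrite inE => /orP[/eqP ->|/sP[W' W's ->]].
      by exists W; rewrite ?mem_head.
    by exists W' => //; rewrite inE W's orbT.
  have [t tV] : exists t, forall W, W \in s -> ~ V W t.
    apply: contrapT => nt; apply: nV; exists s => t; apply: contrapT => ns.
    by apply: nt; exists t => W Ws VWt; apply: ns; exists W.
  by exists t => A /sP[W Ws ->] /=; exact: tV.
- by have [_ _] := Vb W; apply; apply: WE; exists W.
Qed.

End finite_cover.

(** * Suprema, homogeneity and convex hulls *)

Section sup_nneg.
Context {R : realType}.
Local Open Scope ereal_scope.

Lemma sup_nneg_le (I : Type) (D : set I) (F : I -> \bar R) (c : \bar R) :
  0 <= c -> sup_nneg D F <= c <-> forall i, D i -> F i <= c.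
Proof.
move=> c0; split=> [Fc i Di|Fc].
  by apply: le_trans Fc; apply: ereal_sup_ubound; right; exists i.
by apply: ge_ereal_sup => _ [->//|[i Di <-]]; exact: Fc.
Qed.

Lemma sup_nneg_ge0 (I : Type) (D : set I) (F : I -> \bar R) : 0 <= sup_nneg D F.
Proof. by apply: ereal_sup_ubound; left. Qed.

Lemma sup_nneg_ub (I : Type) (D : set I) (F : I -> \bar R) i :
  D i -> F i <= sup_nneg D F.
Proof. by move=> Di; apply: ereal_sup_ubound; right; exists i. Qed.

(** Reduces inequalities between extended numbers to real upper bounds, the only
    ones for which [omegaP] gives a meaning in terms of functions. *)
Lemma le_fin_bound (x y : \bar R) : 0 <= y ->
  (forall r : R, (0 <= r)%R -> y <= r%:E -> x <= r%:E) -> x <= y.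
Proof.
case: y => [r| |] // h; last by rewrite leey.
by apply; rewrite // -lee_fin.
Qed.

(** One inequality suffices: for [l != 0] the other one is the first applied to
    [l^-1] and to the scaled set, and for [l = 0] the right-hand side is 0 by
    the convention on the product of 0 and infinity. *)
Lemma homogeneous_of_le (Y : lmodType R[i]) (Om : set Y -> \bar R) :
  (forall A, 0 <= Om A) ->
  (forall A l, Om [set l *: x | x in A]%R <= (normc l)%:E * Om A) ->
  forall A l, Om [set l *: x | x in A]%R = (normc l)%:E * Om A.
Proof.
move=> Om0 Ole A l; apply/eqP; rewrite eq_le Ole/=.
have [->|l0] := eqVneq l 0%R; first by rewrite ComplexField.Normc.normc0 mul0e.
have nl0 : (0 < normc l)%R by rewrite -ltcR -normcC normr_gt0.
rewrite -lee_pdivlMl//.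
have -> : ((normc l)^-1)%R = normc (l^-1)%R.
  by apply: complexI; rewrite -normcC normfV normcC fmorphV.
suff {1}-> : A = [set l^-1 *: y | y in [set l *: x | x in A]]%R by exact: Ole.
apply/seteqP; split => [x Ax|_ [_ [x Ax <-] <-]]; last by rewrite scalerK.
by exists (l *: x)%R; [exists x|rewrite scalerK].
Qed.

End sup_nneg.

Section hull.
Context {R : realType} {Y : completeNormedModType R[i]}.

Lemma sub_convex_hull (A : set Y) : A `<=` convex_hull A.
Proof. exact: sub_smallest. Qed.

Lemma convex_hull_convex (A : set Y) : @convex_set _ Y (convex_hull A).
Proof.
move=> x y l /set_mem xA /set_mem yA; apply/mem_set => B [Bc AB].
by apply/set_mem/Bc; apply/mem_set; [exact: xA|exact: yA].
Qed.

End hull.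

(** * The functional [omega] *)

Section om.
Context {R : realType} {T : topologicalType}.
Implicit Types (W : Wall R T) (f g : Cb R T) (F G : set (Cb R T)).

(** The slack [e] makes this equivalent to a bound on the infimum defining
    [omega], which need not be attained. *)
Definition oscillation_le F (c : R) := forall W (e : R), 0 < e ->
  \forall t \near wall_filter W, forall f, F f ->
    `|gelfand f W - f t| <= (c + e)%:C.

Lemma omega_ge0 F : (0 <= omega F)%E.
Proof. exact: sup_nneg_ge0. Qed.

Lemma omegaP F (c : R) : 0 <= c -> (omega F <= c%:E)%E <-> oscillation_le F c.
Proof.
move=> c0; split=> [/sup_nneg_le Fc W e e0|Fc].
  have /Fc /(_ W I) infc : (0 <= c%:E)%E by rewrite lee_fin.
  have ce : (c%:E < (c + e)%:E)%E by rewrite lte_fin ltrDl.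
  have /ereal_inf_lt[_ [V Vb <-] /ltW/sup_nneg_le Vc] := le_lt_trans infc ce.
  have ce0 : (0 <= (c + e)%:E)%E by rewrite lee_fin addr_ge0// ltW.
  exists V => // t Vt f Ff.
  have /sup_nneg_le-/(_ ce0) /(_ t Vt) := Vc ce0 f Ff.
  by rewrite lee_fin normcC lecR.
apply/sup_nneg_le => [|W _]; first by rewrite lee_fin.
apply/lee_addgt0Pr => e e0.
have ce0 : (0 <= c%:E + e%:E)%E by rewrite -EFinD lee_fin addr_ge0// ltW.
have [V Vb Vc] := Fc W e e0.
apply: le_trans (ereal_inf_lbound _) _; first by exists V.
apply/sup_nneg_le => // f Ff; apply/sup_nneg_le => // t Vt.
by rewrite -EFinD lee_fin -lecR -normcC; exact: Vc.
Qed.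

Lemma omega_le_of F G :
  (forall c, 0 <= c -> oscillation_le G c -> oscillation_le F c) ->
  (omega F <= omega G)%E.
Proof.
move=> h; apply: le_fin_bound => [|r r0]; first exact: omega_ge0.
by move=> /(omegaP _ r0)/(h r r0)/(omegaP _ r0).
Qed.

Lemma omega_subset F G : F `<=` G -> (omega F <= omega G)%E.
Proof.
move=> FG; apply: omega_le_of => c _ Gc W e e0.
by apply: filterS (Gc W e e0) => t h f /FG; exact: h.
Qed.

(** Around each [f] of the compact set and for [t] close to [W], a function [g]
    near [f] satisfies the estimate with error [3 * (e / 3)]; compactness makes
    the neighborhood of [W] uniform. *)
Lemma compact_oscillation F : compact F -> oscillation_le F 0.
Proof.
move=> /compact_near_coveringP cF W e e0; rewrite add0r.
apply: (cF _ (wall_filter W) (fun t f => `|gelfand f W - f t| <= e%:C)) => f _.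
have e30 : 0 < e / 3 by rewrite divr_gt0.
have e3C : 0 < (e / 3)%:C by rewrite ltcR.
have nf := near_dist_lt f e3C.
have nt := @cvgr_dist_lt _ _ _ _ _ _ _ (@gelfand_cvg _ _ f W) _ e3C.
exists ([set g | `|f - g| < (e / 3)%:C],
    [set t | `|gelfand f W - f t| < (e / 3)%:C]).
  by split; [exact: nf|exact: nt].
move=> [g t] [/= /ltW fg /ltW ft].
have -> : gelfand g W - g t =
  (gelfand g W - gelfand f W) + (gelfand f W - f t) + (f - g) t.
  by rewrite !subrKA.
have -> : e%:C = (e / 3)%:C + (e / 3)%:C + (e / 3)%:C.
  by rewrite -!rmorphD; congr (_%:C); lra.
rewrite (le_trans (ler_normD _ _))// lerD//; last first.
  exact: le_trans (le_Cb_norm (f - g) t) fg.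
rewrite (le_trans (ler_normD _ _))// lerD//.
by apply: le_trans (gelfand_dist _ _ _) _; rewrite distrC.
Qed.

Lemma omega_compact F : compact F -> omega F = 0%E.
Proof.
move=> /compact_oscillation/(omegaP _ (lexx 0)) F0; apply/eqP.
by rewrite eq_le F0 omega_ge0.
Qed.

Lemma omega_setU_finite F G : finite_set F -> omega (F `|` G) = omega G.
Proof.
move=> /finite_compact/compact_oscillation F0; apply/eqP; rewrite eq_le.
rewrite [X in _ && X]omega_subset ?andbT; last exact: subsetUr.
apply: omega_le_of => c c0 Gc W e e0.
apply: filterS (filterI (F0 W e e0) (Gc W e e0)) => t [h1 h2] f.
move=> [Ff|]; last exact: h2.
by apply: le_trans (h1 f Ff) _; rewrite lecR lerD2r.
Qed.

Lemma omega_closure F : omega (closure F) = omega F.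
Proof.
apply/eqP; rewrite eq_le andbC omega_subset; last exact: subset_closure.
apply: omega_le_of => c c0 Fc W e e0.
have e20 : 0 < e / 2 by rewrite divr_gt0.
apply: filterS (Fc W _ e20) => t Ft f Ff.
(* [g] in [F] with [|f - g| < e / 4] costs e / 4 at [W] and e / 4 at [t]. *)
have ball0 : 0 < (e / 4)%:C :> R[i] by rewrite ltcR divr_gt0.
have [g [Fg fg]] := Ff _ (near_dist_lt f ball0).
have -> : gelfand f W - f t =
  (gelfand f W - gelfand g W) + (gelfand g W - g t) - (f - g) t.
  by rewrite subrKA (_ : (f - g) t = f t - g t)// opprB subrKA.
have -> : (c + e)%:C = (e / 4)%:C + (c + e / 2)%:C + (e / 4)%:C.
  by rewrite -!rmorphD; congr (_%:C); lra.
rewrite (le_trans (ler_normB _ _))// lerD//; last first.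
  exact: le_trans (le_Cb_norm (f - g) t) (ltW fg).
rewrite (le_trans (ler_normD _ _))// lerD//; last exact: Ft.
exact: le_trans (gelfand_dist _ _ _) (ltW fg).
Qed.

Lemma omega_scale_le F (l : R[i]) :
  (omega [set l *: f | f in F] <= (normc l)%:E * omega F)%E.
Proof.
have [->|l0] := eqVneq l 0.
  rewrite ComplexField.Normc.normc0 mul0e.
  rewrite -(@omega_compact [set 0]); last exact: compact_set1.
  by apply: omega_subset => _ [f _ <-]; rewrite scale0r.
have nl0 : 0 < normc l by rewrite -ltcR -normcC normr_gt0.
have := omega_ge0 F; case: (omega F) (@omegaP F) => [r| |] // rP r0; last first.
  by rewrite gt0_muley ?leey// lte_fin.
rewrite lee_fin in r0.
have {}rP := (rP r r0).1 (lexx _).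
apply/omegaP => [|W e e0]; first by rewrite mulr_ge0// ltW.
apply: filterS (rP W (e / normc l) _) => [t Ft|]; last by rewrite divr_gt0.
move=> _ [f Ff <-].
have -> : gelfand (l *: f) W - (l *: f) t = l * (gelfand f W - f t).
  have := gelfand_linear l 0 f 0 W.
  by rewrite scale0r addr0 mul0r addr0 => ->; rewrite mulrBr.
have -> : normc l * r + e = normc l * (r + e / normc l).
  by rewrite mulrDr [_ * (e / _)]mulrC divfK// gt_eqF.
by rewrite normrM normcC rmorphM ler_wpM2l ?Ft// lecR ltW.
Qed.

Lemma omega_convex_hull F : omega (convex_hull F) = omega F.
Proof.
apply/eqP; rewrite eq_le andbC omega_subset; last exact: sub_convex_hull.
apply: omega_le_of => c c0 Fc W e e0.
apply: filterS (Fc W _ e0) => t Ft.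
apply: smallest_sub Ft => f g l /set_mem fc /set_mem gc; apply/mem_set.
have -> : f <| l |> g = l%:num *: f + (1 - l%:num) *: g by [].
rewrite /= gelfand_linear.
set a := l%:num.
have [a0 a1] : 0 <= a /\ 0 <= 1 - a by rewrite subr_ge0 /a; split.
have -> : a * gelfand f W + (1 - a) * gelfand g W - (a *: f + (1 - a) *: g) t =
  a * (gelfand f W - f t) + (1 - a) * (gelfand g W - g t).
  by rewrite !mulrBr addrACA -opprD.
have -> : (c + e)%:C = a * (c + e)%:C + (1 - a) * (c + e)%:C.
  by rewrite -mulrDl addrCA subrr addr0 mul1r.
rewrite (le_trans (ler_normD _ _))// !normrM (ger0_norm a0) (ger0_norm a1).
rewrite lerD//.
  exact: ler_wpM2l.
exact: ler_wpM2l.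
Qed.
End om.

(** * The functional [eta] *)

Section eta.
Context {R : realType} {T : topologicalType}.
Variable xi : set R[i] -> \bar R.
Hypothesis xiP : measure_of_noncompactness xi.
Implicit Types (f g : Cb R T) (F G : set (Cb R T)).

Let ev F t : set R[i] := [set f t | f in F].

Lemma eta_ge0 F : (0 <= Defs.eta xi F)%E.
Proof. exact: sup_nneg_ge0. Qed.

Lemma eta_le_of F (c : \bar R) : (0 <= c)%E ->
  (forall t, (xi (ev F t) <= c)%E) -> (Defs.eta xi F <= c)%E.
Proof. by move=> c0 h; apply/(sup_nneg_le _ _ c0) => t _; exact: h. Qed.

Lemma le_eta F t : (xi (ev F t) <= Defs.eta xi F)%E.
Proof. exact: (@sup_nneg_ub _ _ setT (fun t => xi (ev F t))). Qed.

Lemma eta_mono F G : (forall t, (xi (ev F t) <= xi (ev G t))%E) ->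
  (Defs.eta xi F <= Defs.eta xi G)%E.
Proof.
move=> h; apply: eta_le_of => [|t]; first exact: eta_ge0.
exact: le_trans (h t) (le_eta G t).
Qed.

Lemma eta_subset F G : F `<=` G -> (Defs.eta xi F <= Defs.eta xi G)%E.
Proof.
move=> FG; apply: eta_mono => t; apply: (mnc_le xiP) => _ [f Ff <-].
by exists f => //; exact: FG.
Qed.

Lemma eta_eq0 F : Defs.eta xi F = 0%E <-> forall t, compact (closure (ev F t)).
Proof.
split=> [F0 t|h].
  by apply/(mnc_compact xiP)/eqP; rewrite eq_le (mnc_ge0 xiP) andbT -F0 le_eta.
apply/eqP; rewrite eq_le eta_ge0 andbT; apply: eta_le_of => // t.
by rewrite ((mnc_compact xiP _).2 (h t)).
Qed.

Lemma ev_continuous (t : T) : continuous (fun f : Cb R T => f t).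
Proof.
move=> f; have FF : Filter (nbhs f) by exact: nbhs_filter.
apply/cvgrPdist_lt => e e0; apply: filterS (near_dist_lt f e0) => g fg.
exact: le_lt_trans (le_Cb_norm (f - g) t) fg.
Qed.

Lemma eta_compact F : compact (closure F) -> Defs.eta xi F = 0%E.
Proof.
move=> cF; apply/eta_eq0 => t.
have cFt : compact (ev (closure F) t).
  apply: continuous_compact cF; apply: continuous_subspaceT.
  exact: ev_continuous.
apply: (subclosed_compact _ cFt); first exact: closed_closure.
have /closure_id -> := @compact_closed R[i] _ (@norm_hausdorff _ R[i]) cFt.
by apply: closureS => _ [f Ff <-]; exists f => //; exact: subset_closure.
Qed.

(** The values of [F] and [G] at [t] may overlap even if [F] and [G] are
    disjoint, so the axiom on finite unions is applied to those values of [F]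
    that [G] does not take. *)
Lemma eta_setU_finite F G : finite_set F ->
  Defs.eta xi (F `|` G) = Defs.eta xi G.
Proof.
move=> Ff; apply/eqP; rewrite eq_le.
rewrite [X in _ && X]eta_subset ?andbT; last exact: subsetUr.
apply: eta_mono => t.
rewrite -(mnc_finite xiP (A := ev F t `\` ev G t) (B := ev G t)); last first.
- by apply/seteqP; split => // z [[]].
- by apply: finite_setD; exact: finite_image.
apply: (mnc_le xiP) => _ [f [Ff'|Gf] <-].
  have [Gft|nGft] := pselect (ev G t (f t)); first by right.
  by left; split => //; exists f.
by right; exists f.
Qed.

Lemma eta_closure F : Defs.eta xi (closure F) = Defs.eta xi F.
Proof.
apply/eqP; rewrite eq_le andbC eta_subset; last exact: subset_closure.
apply: eta_mono => t; rewrite -(mnc_closure xiP (ev F t)).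
apply: (mnc_le xiP) => _ [f Ff <-] B fB.
have [g [Fg gB]] := Ff _ (ev_continuous fB).
by exists (g t); split => //; exists g.
Qed.

Lemma eta_scale_le F (l : R[i]) :
  (Defs.eta xi [set l *: f | f in F] <= (normc l)%:E * Defs.eta xi F)%E.
Proof.
have nl0 : (0 <= (normc l)%:E)%E by rewrite lee_fin normc_ge0.
apply: eta_le_of => [|t]; first by rewrite mule_ge0// eta_ge0.
have -> : ev [set l *: f | f in F] t = [set l *: z | z in ev F t].
  apply/seteqP; split => [_ [_ [f Ff <-] <-]|_ [_ [f Ff <-] <-]].
    by exists (f t) => //; exists f.
  by exists (l *: f) => //; exists f.
by rewrite (mnc_scale xiP) lee_wpmul2l// le_eta.
Qed.

Lemma eta_convex_hull F : Defs.eta xi (convex_hull F) = Defs.eta xi F.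
Proof.
apply/eqP; rewrite eq_le andbC eta_subset; last exact: sub_convex_hull.
apply: eta_mono => t; rewrite -(mnc_convex_hull xiP (ev F t)).
apply: (mnc_le xiP) => _ [f Ff <-].
suff : convex_hull F `<=` [set f | convex_hull (ev F t) (f t)] by apply.
apply: smallest_sub => [g h l /set_mem gt /set_mem ht|g Fg /=].
  apply/mem_set => /=; apply/set_mem.
  by apply: (@convex_hull_convex _ _ (ev F t) (g t) (h t) l); apply/mem_set.
by apply: sub_convex_hull; exists g.
Qed.

End eta.

(** * Relative compactness *)

Section relatively_compact.
Context {R : realType} {T : topologicalType}.

(** An Arzela-Ascoli theorem, with almost constancy on the pieces of a finite
    cover in place of equicontinuity. *)
Lemma compact_of_oscillation (F : set (Cb R T)) :
  closed F -> oscillation_le F 0 ->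
  (forall t, compact (closure [set f t | f in F])) -> compact F.
Proof.
move=> clF F0 cF; rewrite compact_ultra => G GU GF.
suff /cauchy_cvgP/cvg_ex[f Gf] : cauchy G.
  exists f; split => //.
  apply: clF => B fB.
  have /filter_ex[g FBg] : G (F `&` B) by apply: filterI => //; exact: Gf.
  by exists g.
apply/cauchyP => _ /gt0C[e e0 ->].
have e60 : 0 < e / 6 by rewrite divr_gt0.
have /choice[V VP] : forall W : Wall R T, exists V, wall_base W V /\
    forall t f, V t -> F f -> `|gelfand f W - f t| <= (e / 6)%:C.
  move=> W; have [V Vb VP] := F0 W _ e60; exists V; split => // t f Vt Ff.
  by have := VP t Vt f Ff; rewrite add0r.
have [s sV] := wall_finite_cover (fun W => (VP W).1).
(* The six steps of the triangle inequality below add up to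
   4 * (e / 6) + 2 * (e / 12) = e - e / 6, leaving room for the strict
   inequality that defines balls. *)
have loc W : exists2 S, G S & forall f g t, S f -> S g -> V W t ->
    `|f t - g t| <= (e - e / 6)%:C.
  have [[t Vt]|/nonemptyPn VW0] := pselect (V W !=set0); last first.
    by exists setT; [exact: filterT|move=> f g t _ _; rewrite VW0].
  have e12 : 0 < (e / 12)%:C :> R[i] by rewrite ltcR divr_gt0.
  have [|z [_ clz]] := cF t ((fun f : Cb R T => f t) @ G) _.
    by apply: (@filterS _ G _ F) GF => f Ff; apply: subset_closure; exists f.
  have Gz : G [set f : Cb R T | `|z - f t| < (e / 12)%:C].
    (* [z] being a cluster point, the ultrafilter cannot contain the
       complement. *)
    have [//|Gn] :=
      in_ultra_setVsetC [set f : Cb R T | `|z - f t| < (e / 12)%:C] GU.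
    have [|w [/= nw zw]] :=
      clz [set w | ~ `|z - w| < (e / 12)%:C] _ _ (near_dist_lt z e12).
      exact: Gn.
    by case: nw.
  exists (F `&` [set f : Cb R T | `|z - f t| < (e / 12)%:C]).
    exact: filterI.
  move=> f g t' [Ff /ltW fz] [Fg /ltW gz] Vt'.
  have -> : f t' - g t' = (f t' - gelfand f W) + (gelfand f W - f t)
    + (f t - z) + (z - g t) + (g t - gelfand g W) + (gelfand g W - g t').
    by rewrite !subrKA.
  have -> : (e - e / 6)%:C = (e / 6)%:C + (e / 6)%:C + (e / 12)%:C
     + (e / 12)%:C + (e / 6)%:C + (e / 6)%:C.
    by rewrite -!rmorphD; congr (_%:C); lra.
  have [_ VWP] := VP W.
  rewrite (le_trans (ler_normD _ _))// lerD//; last exact: VWP.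
  rewrite (le_trans (ler_normD _ _))// lerD//; last first.
    by rewrite distrC; exact: VWP.
  rewrite (le_trans (ler_normD _ _))// lerD//.
  rewrite (le_trans (ler_normD _ _))// lerD//; last by rewrite distrC.
  rewrite (le_trans (ler_normD _ _))// lerD//; last exact: VWP.
  by rewrite distrC; exact: VWP.
have [S GS SP] : exists2 S, G S & forall W, W \in s -> forall f g t,
    S f -> S g -> V W t -> `|f t - g t| <= (e - e / 6)%:C.
  elim: s {sV} => [|W s [S GS SP]]; first by exists setT; [exact: filterT|].
  have [S' GS' SP'] := loc W; exists (S `&` S'); first exact: filterI.
  move=> W'; rewrite in_cons => /orP[/eqP ->|W's] f g t [Sf Sf'] [Sg Sg'].
    exact: SP'.
  exact: SP W' W's f g t Sf Sg.
have [f Sf] := filter_ex GS.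
exists f; apply: filterS GS => g Sg; rewrite -ball_normE /ball_/=.
apply: (@le_lt_trans _ _ (e - e / 6)%:C); last by rewrite ltcR; lra.
apply: Cb_norm_le => [|t]; first by lra.
by have [W Ws VWt] := sV t; exact: SP W Ws f g t Sf Sg VWt.
Qed.

End relatively_compact.

Theorem theorem12 (R : realType) (T : topologicalType)
    (T_crs : completely_regular_space T) (T_haus : hausdorff_space T)
    (xi : set R[i] -> \bar R)
    (xi_mnc : measure_of_noncompactness xi) :
  measure_of_noncompactness (@Omega R T xi).
Proof.
have Om0 F : (0 <= @Omega R T xi F)%E by rewrite adde_ge0// ?omega_ge0 ?eta_ge0.
have Omcl F : Omega xi (closure F) = Omega xi F.
  by rewrite /Omega omega_closure (eta_closure xi_mnc).
split => //.
- move=> F; split=> [F0|cF]; last first.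
    rewrite /Omega (eta_compact xi_mnc cF) adde0 -omega_closure.
    exact: omega_compact.
  have /eqP : Omega xi (closure F) = 0%E by rewrite Omcl.
  rewrite padde_eq0 ?omega_ge0 ?eta_ge0// => /andP[/eqP om0 /eqP].
  move=> /(eta_eq0 xi_mnc) eta0.
  apply: compact_of_oscillation eta0; first exact: closed_closure.
  by apply/omegaP => //; rewrite om0.
- by move=> F G FG; rewrite leeD// ?omega_subset ?(eta_subset xi_mnc).
- apply: homogeneous_of_le => // F l.
  rewrite ge0_muleDr ?omega_ge0 ?eta_ge0//.
  by rewrite leeD// ?omega_scale_le ?(eta_scale_le xi_mnc).
- move=> F G Ff _; rewrite /Omega omega_setU_finite//.
  by rewrite (eta_setU_finite xi_mnc).
- by move=> F; rewrite /Omega omega_convex_hull (eta_convex_hull xi_mnc).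
Qed.
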